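(* Let $\mathcal{X}$ be a real Hilbert space with scalar product $\phi:\mathcal{X}\times\mathcal{X}\to\mathbb{R}$, and let $\rho:\mathcal{X}\to[0,\infty)$ be a continuous semi-norm. Define $$G=\{x\in\mathcal{X}:\ \phi(x,y)=0\ \text{whenever}\ y\in\mathcal{X}\ \text{and}\ \rho(y)=0\}.$$ Let $\rho_G$ be the norm obtained by restricting $\rho$ to $G$. Then for every $f\in\mathcal{X}$ there exists some $f_0\in G$ such that the following two problems are equivalent, i.e., they have the same set of minimizers: $$\inf\{\rho(f-x)+\rho^*(x):\ x\in\mathcal{X}\},\qquad \inf\{\rho_G(f_0-x)+\rho_G^*(x):\ x\in G\}.$$
   Context: The Legendre transform $\rho^*:\mathcal{X}\to[0,\infty]$ of $\rho$ is $\rho^*(x)=\sup\{\phi(x,y)-\rho(y):\ y\in\mathcal{X}\}$. The Legendre transform $\rho_G^*:G\to[0,\infty]$ of $\rho_G$ is taken over $G$: for $y\in G$, $\rho_G^*(y)=\sup\{\phi(w,y)-\rho_G(w):\ w\in G\}$. *)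

(* Defs.v *)
From HB Require Import structures.
From mathcomp Require Import all_boot all_order all_algebra.
From mathcomp Require Import all_classical all_reals all_analysis.

Set Implicit Arguments.
Unset Strict Implicit.
Unset Printing Implicit Defensive.

Import Order.TTheory GRing.Theory Num.Theory.
Import numFieldNormedType.Exports.
Local Open Scope classical_set_scope.
Local Open Scope ring_scope.

(* A real Hilbert space is a complete normed space X together with a symmetric
   positive definite form phi satisfying [hilbert_norm phi]. *)
Definition hilbert_norm (R : realType) (X : completeNormedModType R)
    (phi : {dot X for idfun}) : Prop :=
  forall x : X, `|x| = Num.sqrt (phi x x).

Record seminorm (R : realType) (X : lmodType R) (rho : X -> R) : Prop := {
  seminorm_ge0 : forall x, 0 <= rho x ;
  seminormD : forall x y, rho (x + y) <= rho x + rho y ;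
  seminormZ : forall (a : R) x, rho (a *: x) = `|a| * rho x }.

Section Gspace.
Context (R : realType) (X : lmodType R).
Variables (phi : {dot X for idfun}) (rho : X -> R).

Definition Gset : set X := [set x | forall y : X, rho y = 0 -> phi x y = 0].

Definition Gpred : {pred X} := [pred x | x \in Gset].

Lemma GpredP (x : X) : reflect (Gset x) (x \in Gpred).
Proof. by apply: (iffP idP) => [/set_mem|/mem_set]. Qed.

Lemma Gpred_submod : submod_closed Gpred.
Proof.
split=> [|a u v]; first by apply/GpredP => y _; rewrite linear0l.
move=> /GpredP hu /GpredP hv; apply/GpredP => y y0.
by rewrite linearPl /= hu // hv // mulr0 addr0.
Qed.

HB.instance Definition _ :=
  GRing.isSubmodClosed.Build R X Gpred Gpred_submod.

(* G as a real vector space of its own, with [val : Gspace -> X] the inclusion. *)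
Definition Gspace : Type := {x : X | x \in Gpred}.

HB.instance Definition _ := SubChoice.on Gspace.
HB.instance Definition _ := [SubChoice_isSubLmodule of Gspace by <:].

Definition phiG (x y : Gspace) : R := phi (val x) (val y).

Definition rhoG (x : Gspace) : R := rho (val x).

Lemma rhoG_seminorm : seminorm rho -> seminorm rhoG.
Proof.
case=> h0 hD hZ; split=> [x|x y|a x]; rewrite /rhoG; first exact: h0.
  by rewrite GRing.valD; exact: hD.
by rewrite GRing.valZ; exact: hZ.
Qed.

Lemma rhoG_eq0 (x : Gspace) : rhoG x = 0 -> x = 0.
Proof.
move=> hx; have /GpredP/(_ _ hx) hxx := valP x.
apply: val_inj; rewrite GRing.val0; apply/eqP/negPn/negP => x0.
have : 0 < phi (val x) (val x) by exact: neq0_dnorm_gt0.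
by rewrite hxx ltxx.
Qed.

End Gspace.

Section Problem.
Local Open Scope ereal_scope.
Context (R : realType).

(* The value is nonnegative as soon as V has a 0 with b x 0 = rho 0 = 0; it may
   be +oo. *)
Definition legendre (V : Type) (b : V -> V -> R) (rho : V -> R) (x : V) :
    \bar R :=
  ereal_sup (range (fun y : V => (b x y - rho y)%:E)).

Definition objective (V : zmodType) (b : V -> V -> R) (rho : V -> R) (f x : V) :
    \bar R :=
  (rho (f - x)%R)%:E + legendre b rho x.

Definition minimizers (V : Type) (J : V -> \bar R) : set V :=
  [set x | J x = ereal_inf (range J)].

End Problem.

(* Main.v *)
Require Import Defs.
From HB Require Import structures.
From mathcomp Require Import all_boot all_order all_algebra.
From mathcomp Require Import all_classical all_reals all_analysis.
From mathcomp Require Import ring lra.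
Set Implicit Arguments.
Unset Strict Implicit.
Unset Printing Implicit Defensive.

Import Order.TTheory GRing.Theory Num.Theory.
Import numFieldNormedType.Exports.
Local Open Scope classical_set_scope.
Local Open Scope ring_scope.

(** The set G is the orthogonal complement of N, the kernel of rho. As rho is
    a continuous seminorm, N is a closed subspace, so the projection theorem
    ([orthogonal_projection]) splits every point as an element of G plus an
    element of N ([Gspace_decomposition]); f0 is the G-component of f.

    Adding an element of N does not change rho ([seminorm_addker]), hence
    rho (f - x) = rho (f0 - x) for all x. The conjugate of rho is +oo off G:
    if x pairs nontrivially with some y in N, then phi x is unbounded on the
    line through y while rho vanishes there ([legendre_notin_Gset]). On G it is
    the conjugate of the restricted norm, because neither phi x nor rho sees
    the N-component of the point over which the supremum runs
    ([legendre_phiG]). So the first objective extends the second one by +oo.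
    The second one is finite at 0, so the added points lie outside the set of
    minimizers, which is therefore the same for both problems
    ([minimizers_image]). *)

(** * Real inner products *)

Lemma dotC (R : realType) (X : lmodType R) (phi : {dot X for idfun}) (x y : X) :
  phi x y = phi y x.
Proof. by rewrite (hermC phi) expr0 mul1r. Qed.

(** The rules for sums and scalings are restated with [phi] as a [{dot X for
    idfun}]: the general ones leave terms in which [phi] appears through a
    weaker structure, and these no longer match. *)
Lemma dotZl (R : realType) (X : lmodType R) (phi : {dot X for idfun})
    (a : R) (x y : X) : phi (a *: x) y = a * phi x y.
Proof. exact: linearZl_LR. Qed.

Lemma dotZr (R : realType) (X : lmodType R) (phi : {dot X for idfun})
    (a : R) (x y : X) : phi x (a *: y) = a * phi x y.
Proof. exact: linearZr_LR. Qed.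

Lemma dotDr (R : realType) (X : lmodType R) (phi : {dot X for idfun})
    (x y z : X) : phi x (y + z) = phi x y + phi x z.
Proof. exact: linearDr. Qed.

Lemma dotBl (R : realType) (X : lmodType R) (phi : {dot X for idfun})
    (x y z : X) : phi (x - y) z = phi x z - phi y z.
Proof. exact: linearBl. Qed.

Lemma dotBr (R : realType) (X : lmodType R) (phi : {dot X for idfun})
    (x y z : X) : phi x (y - z) = phi x y - phi x z.
Proof. exact: linearBr. Qed.

Lemma hilbert_normE (R : realType) (X : completeNormedModType R)
    (phi : {dot X for idfun}) (x : X) :
  hilbert_norm phi -> `|x| ^+ 2 = phi x x.
Proof.
move=> ->; rewrite sqr_sqrtr//; have [->|x0] := eqVneq x 0.
  by rewrite linear0l.
exact/ltW/neq0_dnorm_gt0.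
Qed.

Lemma parallelogram (R : realType) (X : completeNormedModType R)
    (phi : {dot X for idfun}) (u v : X) : hilbert_norm phi ->
  `|u + v| ^+ 2 + `|u - v| ^+ 2 = 2 * `|u| ^+ 2 + 2 * `|v| ^+ 2.
Proof.
move=> hphi; rewrite !(hilbert_normE _ hphi).
by rewrite linearBl linearDl !linearBr !linearDr; ring.
Qed.

(** * Projection onto a closed subspace *)

(** Points of N that are nearly closest to f are close to each other: by the
    parallelogram law, their distance is controlled by how much their midpoint,
    which is in N, could improve on them. The sets of nearly closest points
    thus generate a Cauchy filter, and its limit is a closest point. *)
Lemma closest_point (R : realType) (X : completeNormedModType R)
    (phi : {dot X for idfun}) (N : set X) (f : X) : hilbert_norm phi ->
  closed N -> N !=set0 -> (forall u v, N u -> N v -> N (2^-1 *: (u + v))) ->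
  exists2 p, N p & forall n, N n -> `|f - p| <= `|f - n|.
Proof.
move=> hphi clN [n0 Nn0] midN.
pose D := [set `|f - n| ^+ 2 | n in N]; pose d := inf D.
have lbD : has_lbound D by exists 0 => _ [n _ <-]; rewrite sqr_ge0.
have infD : has_inf D by split=> //; exists (`|f - n0| ^+ 2), n0.
have dle n : N n -> d <= `|f - n| ^+ 2 by move=> Nn; apply: ge_inf => //; exists n.
pose A (e : R) := [set n | N n /\ `|f - n| ^+ 2 < d + e].
pose F := filter_from [set e : R | 0 < e] A.
have FA e : 0 < e -> F (A e) by move=> e0; exists e.
have FF : ProperFilter F.
  apply: filter_from_proper; last first.
    move=> e e0; have [_ [n Nn <-] nlt] := inf_adherent e0 infD.
    by exists n.
  apply: filter_from_filter; first by exists 1 => /=.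
  move=> e1 e2 e10 e20; exists (Num.min e1 e2) => /=.
    by rewrite lt_min e10.
  by move=> n [Nn]; rewrite -ltrBlDl lt_min !ltrBlDl => /andP[? ?]; split.
(* Parallelogram law for f - n and f - m, whose half-sum is at squared distance
   at least d from 0. *)
have diamA e n m : A e n -> A e m -> `|n - m| ^+ 2 < 4 * e.
  move=> [Nn nlt] [Nm mlt].
  have := parallelogram (f - n) (f - m) hphi.
  have -> : f - n - (f - m) = m - n by rewrite opprB addrC addrA subrK.
  have -> : f - n + (f - m) = 2 *: (f - 2^-1 *: (n + m)).
    rewrite scalerBr scalerA mulfV ?pnatr_eq0// scale1r scaler_nat mulr2n.
    by rewrite addrACA -opprD.
  rewrite normrZ exprMn [`|2|]ger0_norm// [`|m - n|]distrC.
  have := dle _ (midN _ _ Nn Nm).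
  set a := `|_ - 2^-1 *: _| ^+ 2; set b := `|n - m| ^+ 2. lra.
have cF : cvg F.
  apply/cauchy_cvgP/cauchy_exP => e e0.
  have e40 : 0 < e ^+ 2 / 4 by rewrite divr_gt0 ?exprn_gt0.
  have [n An] := filter_ex (FA _ e40).
  exists n; apply: filterS (FA _ e40) => m Am.
  rewrite -ball_normE /ball_ /= -(ltr_pXn2r (n := 2)) ?nnegrE ?(ltW e0)//.
  by have := diamA _ _ _ An Am; rewrite mulrC divfK// pnatr_eq0.
exists (lim F).
  have cidF : id @ F --> lim F by exact: cF.
  apply: (@closed_cvg _ _ F FF id N clN _ _ cidF).
  by exists 1 => //= n [].
move=> n Nn; rewrite -(ler_pXn2r (n := 2)) ?nnegrE//.
apply: le_trans (dle _ Nn); apply/ler_addgt0Pr => e e0.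
have cfF : (fun x => `|f - x| ^+ 2) @ F --> `|f - lim F| ^+ 2.
  have cN : (fun x => `|f - x|) @ F --> `|f - lim F|.
    by apply: cvg_norm; apply: cvgB cF; exact: cvg_cst.
  rewrite expr2; under eq_fun do rewrite expr2.
  exact: cvgM.
apply: (@closed_cvg _ _ F FF _ _ (@closed_le R (d + e)) _ _ cfF).
by apply: filterS (FA _ e0) => m [_ /ltW].
Qed.

(** The closest point p works: if f - p had a nonzero product with n in N,
    moving p along n would bring it strictly closer to f. *)
Lemma orthogonal_projection (R : realType) (X : completeNormedModType R)
    (phi : {dot X for idfun}) (N : set X) (f : X) : hilbert_norm phi ->
  closed N -> N 0 -> (forall a u v, N u -> N v -> N (a *: u + v)) ->
  exists2 p, N p & forall n, N n -> phi (f - p) n = 0.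
Proof.
move=> hphi clN N0 NP.
have [||p Np pmin] := closest_point f hphi clN.
- by exists 0.
- by move=> u v Nu Nv; rewrite scalerDr -[_ *: v]addr0; apply: (NP) => //; exact: NP.
exists p => // n Nn; apply/eqP/negPn/negP => pn0.
have n0 : n != 0 by apply: contra_neq pn0 => ->; rewrite linear0r.
have nn0 : 0 < phi n n by exact: neq0_dnorm_gt0.
(* The step along n that minimizes the distance to f. *)
pose t := phi (f - p) n / phi n n.
have := pmin _ (NP t _ _ Nn Np).
rewrite -(ler_pXn2r (n := 2)) ?nnegrE// !(hilbert_normE _ hphi).
have -> : f - (t *: n + p) = f - p - t *: n by rewrite opprD addrA addrAC.
move: (f - p) @t pn0 => u t un0.
have -> : phi (u - t *: n) (u - t *: n) = phi u u - (phi u n) ^+ 2 / phi n n.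
  rewrite dotBl !dotBr !dotZl !dotZr (dotC _ n u) /t.
  by field; rewrite gt_eqF.
have : 0 < (phi u n) ^+ 2 / phi n n by rewrite divr_gt0// exprn_even_gt0.
lra.
Qed.

(** * Seminorms and their kernels *)

Lemma seminorm0 (R : realType) (X : lmodType R) (rho : X -> R) :
  seminorm rho -> rho 0 = 0.
Proof. by case=> _ _ hZ; rewrite -(scale0r 0) hZ normr0 mul0r. Qed.

Lemma seminormN (R : realType) (X : lmodType R) (rho : X -> R) (x : X) :
  seminorm rho -> rho (- x) = rho x.
Proof. by case=> _ _ hZ; rewrite -scaleN1r hZ normrN normr1 mul1r. Qed.

Lemma seminorm_addker (R : realType) (X : lmodType R) (rho : X -> R) (x n : X) :
  seminorm rho -> rho n = 0 -> rho (x + n) = rho x.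
Proof.
move=> hrho n0; apply/eqP; rewrite eq_le; apply/andP; split.
  by rewrite -[leRHS]addr0 -n0; exact: seminormD.
rewrite -[x in leLHS](addrK n) -[leRHS]addr0 -n0 -(seminormN n hrho).
exact: seminormD.
Qed.

Lemma seminorm_kerP (R : realType) (X : lmodType R) (rho : X -> R)
    (a : R) (u v : X) :
  seminorm rho -> rho u = 0 -> rho v = 0 -> rho (a *: u + v) = 0.
Proof.
by move=> hrho u0 v0; rewrite seminorm_addker// seminormZ// u0 mulr0.
Qed.

(** * The space G and the Legendre transforms *)

Lemma Gspace_decomposition (R : realType) (X : completeNormedModType R)
    (phi : {dot X for idfun}) (rho : X -> R) (f : X) :
  hilbert_norm phi -> seminorm rho -> continuous rho ->
  exists g : Gspace phi rho, rho (f - val g) = 0.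
Proof.
move=> hphi hrho crho.
have clN : closed [set x | rho x = 0].
  exact: ((continuous_closedP rho).1 crho _ (@closed_eq R 0)).
have [||p Np fpN] := orthogonal_projection f hphi clN.
- exact: seminorm0.
- by move=> a u v; exact: seminorm_kerP.
have gG : f - p \in Gpred phi rho by apply/GpredP.
by exists (Sub (f - p) gG); rewrite SubK opprB addrC subrK.
Qed.

(** Replacing y by its component in G changes neither [phi x y], since x is in
    G, nor [rho y]; so restricting the supremum to G loses nothing. *)
Lemma legendre_phiG (R : realType) (X : completeNormedModType R)
    (phi : {dot X for idfun}) (rho : X -> R) (x : Gspace phi rho) :
  hilbert_norm phi -> seminorm rho -> continuous rho ->
  legendre phi rho (val x) = legendre (@phiG R X phi rho) (@rhoG R X phi rho) x.
Proof.
move=> hphi hrho crho; rewrite /legendre; congr ereal_sup.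
apply/seteqP; split=> _ [y _ <-]; last by exists (val y).
have [g yg0] := Gspace_decomposition y hphi hrho crho.
exists g => //; rewrite /phiG /rhoG -(subrK (val g) y) [_ + val g]addrC.
have /GpredP/(_ _ yg0) xyg0 := valP x.
by rewrite (seminorm_addker _ hrho yg0) dotDr xyg0 addr0.
Qed.

Lemma legendre_notin_Gset (R : realType) (X : lmodType R)
    (phi : {dot X for idfun}) (rho : X -> R) (x : X) :
  seminorm rho -> ~ Gset phi rho x -> legendre phi rho x = +oo%E.
Proof.
move=> hrho /existsNP[y /not_implyP[y0 /eqP xy0]].
(* On the line spanned by y, rho is 0 and phi x takes every real value A. *)
apply/eqyP => A A0; apply: ereal_sup_ubound; exists ((A / phi x y) *: y) => //.
by rewrite dotZr seminormZ// y0 mulr0 subr0 divfK.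
Qed.

Lemma legendre0 (R : realType) (X : lmodType R)
    (phi : {dot X for idfun}) (rho : X -> R) :
  seminorm rho -> (legendre phi rho 0%R <= 0)%E.
Proof.
move=> hrho; apply: ge_ereal_sup => _ [y _ <-].
by rewrite linear0l sub0r lee_fin oppr_le0 seminorm_ge0.
Qed.

(** * Equality of the minimizers *)

(** Extending an objective by +oo keeps its infimum. It creates no minimizer
    if some value is below +oo; if all values are +oo, every added point
    becomes a minimizer, hence the point [u0]. *)
Lemma minimizers_image (R : realType) (U V : Type) (i : U -> V)
    (J : V -> \bar R) (K : U -> \bar R) (u0 : U) :
  (forall u, J (i u) = K u) -> (forall x, ~ range i x -> J x = +oo%E) ->
  (K u0 < +oo)%E -> minimizers J = i @` minimizers K.
Proof.
move=> JK Joo Kfin.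
have infE : ereal_inf (range J) = ereal_inf (range K).
  apply/eqP; rewrite eq_le; apply/andP; split.
    apply: le_ereal_inf_tmp => _ [u _ <-]; apply: ereal_inf_lbound.
    by exists (i u).
  apply: le_ereal_inf_tmp => _ [x _ <-].
  have [[u _ <-]|xi] := pselect (range i x); last by rewrite Joo// leey.
  by rewrite JK; apply: ereal_inf_lbound; exists u.
rewrite /minimizers infE; apply/seteqP; split=> [x /= xmin|_ [u /= umin <-]].
  have [[u _ ux]|xi] := pselect (range i x).
    by exists u => //=; rewrite -JK ux.
  have : (ereal_inf (range K) <= K u0)%E by apply: ereal_inf_lbound; exists u0.
  by rewrite -xmin Joo// leye_eq => /eqP Koo; rewrite Koo ltxx in Kfin.
by rewrite /= JK.
Qed.

Theorem lemma3p2 (R : realType) (X : completeNormedModType R)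
    (phi : {dot X for idfun}) (hphi : hilbert_norm phi)
    (rho : X -> R) (rho_semi : seminorm rho) (rho_cont : continuous rho)
    (f : X) :
  exists f0 : Gspace phi rho,
    minimizers (objective phi rho f) =
    val @` minimizers (objective (@phiG R X phi rho) (@rhoG R X phi rho) f0).
Proof.
have [f0 ff0] := Gspace_decomposition f hphi rho_semi rho_cont; exists f0.
have objE (x : Gspace phi rho) : objective phi rho f (val x) =
    objective (@phiG R X phi rho) (@rhoG R X phi rho) f0 x.
  rewrite /objective legendre_phiG//; congr (_%:E + _)%E.
  rewrite /rhoG GRing.valB -(seminorm_addker (val f0 - val x) rho_semi ff0).
  by congr rho; rewrite [RHS]addrC addrA subrK.
apply: (minimizers_image (u0 := 0) objE) => [x xG|].
  rewrite /objective legendre_notin_Gset// => Gx.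
  have Gpx : x \in Gpred phi rho by apply/GpredP.
  by apply: xG; exists (Sub x Gpx); rewrite ?SubK.
rewrite -objE GRing.val0 /objective.
by rewrite (le_lt_trans (leeD2l _ (legendre0 phi rho_semi)))// adde0 ltry.
Qed.
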